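(* Let $n$ be a positive integer and let $s$ and $\mathbf x=(x_1,\ldots,x_n)$ be variables. For $0\le p\le n$ let $CTV_p(s,\mathbf x)$ and $CTB_p(s,\mathbf x)$ be the constant terms of the Laurent series in $t$ at $t=0$ of $$V_p(s,\mathbf x)(t)=\sum_{|J|=p}\frac{e^{ts}}{\prod_{a\in J}(-t x_a)},\qquad B_p(s,\mathbf x)(t)=\sum_{|J|=p}\frac{e^{ts}}{\prod_{a\in J}(1-e^{t x_a})},$$ respectively, where $J$ runs over the subsets of $\{1,\ldots,n\}$ of cardinality $p$. Then the following identities of meromorphic functions of $(s,x_1,\ldots,x_n)$ hold. If $n$ is odd and $m=(n+1)/2$, then $$\sum_{p=0}^n(-1)^{n-p}(p+1)!\,CTV_p(s,\mathbf x)=\sum_{p=m}^n(-1)^p\sum_{i=1}^{p+1-m}(-1)^{m-i}\binom{p+1}{m+i}\,2\,i\,CTB_p(-is,\mathbf x).$$ If $n$ is even and $m=n/2$, then $$\sum_{p=0}^n(-1)^{n-p}(p+1)!\,CTV_p(s,\mathbf x)=\sum_{p=m}^n(-1)^p\sum_{i=1}^{p+1-m}(-1)^{m+1-i}\left(\binom{p+1}{m+i}-\binom{p+1}{m+i+1}\right) i\,CTB_p(-is,\mathbf x).$$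
   Context: The constant term of a Laurent series in $t$ is its coefficient of $t^0$. $CTB_p(-is,\mathbf x)$ means $CTB_p$ with $s$ replaced by $-is$, where $i$ is the integer summation index (not the imaginary unit). For $p=0$ the only subset is $J=\emptyset$ and the empty product is $1$, so $V_0(s,\mathbf x)(t)=B_0(s,\mathbf x)(t)=e^{ts}$. $\binom{a}{b}=0$ when $b>a\ge 0$. *)

(* Defs.v *)
From mathcomp Require Import all_boot all_order all_algebra.
From mathcomp Require Export complex.
From mathcomp Require Import all_classical all_reals all_analysis.

Set Implicit Arguments.
Unset Strict Implicit.
Unset Printing Implicit Defensive.

Import Order.TTheory GRing.Theory Num.Theory.
Import numFieldNormedType.Exports.

Local Open Scope classical_set_scope.
Local Open Scope ring_scope.

(* The definitions are over an abstract numFieldType because that is where the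
   library provides the topology given by the norm; they are meant for
   C := R[i], the complex numbers. *)

(* The complex exponential; the library's expR is the same limit over R. *)
Definition cexp {C : numFieldType} (z : C) : C :=
  limn (series (fun k => z ^+ k / k`!%:R)).

(* sum_k a_k t^k is the Laurent series of f at 0: it has finitely many
   nonzero coefficients of negative index and converges to f on a punctured
   disc 0 < |t| < r.  In the order of a numFieldType, 0 < r makes r real. *)
Definition laurent_series_at0 {C : numFieldType} (f : C -> C) (a : int -> C)
    : Prop :=
  exists (N : nat) (r : C),
    [/\ 0 < r,
        forall k : int, k < - N%:Z -> a k = 0
      & forall t : C, 0 < `|t| < r ->
          series (fun j : nat => a (j%:Z - N%:Z) * t ^ (j%:Z - N%:Z)) @ \oo
            --> f t].

(* The Laurent series is unique when it exists, so the choice made by xget is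
   immaterial; the value is 0 if f has no such series. *)
Definition constant_term {C : numFieldType} (f : C -> C) : C :=
  xget 0 [set c | exists2 a : int -> C, laurent_series_at0 f a & a 0 = c].

Definition V {C : numFieldType} {n : nat} (p : nat) (s : C) (x : 'I_n -> C)
    (t : C) : C :=
  \sum_(J : {set 'I_n} | #|J| == p)
    cexp (t * s) / \prod_(a in J) (- (t * x a)).

Definition B {C : numFieldType} {n : nat} (p : nat) (s : C) (x : 'I_n -> C)
    (t : C) : C :=
  \sum_(J : {set 'I_n} | #|J| == p)
    cexp (t * s) / \prod_(a in J) (1 - cexp (t * x a)).

Definition CTV {C : numFieldType} {n : nat} (p : nat) (s : C) (x : 'I_n -> C)
    : C := constant_term (V p s x).

Definition CTB {C : numFieldType} {n : nat} (p : nat) (s : C) (x : 'I_n -> C)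
    : C := constant_term (B p s x).

(* Main.v *)
Require Import Defs.
From mathcomp Require Import all_boot all_order all_algebra.
From mathcomp Require Import complex reals.
From mathcomp Require Import all_classical all_reals all_analysis.
From mathcomp Require Import ring zify.

Set Implicit Arguments.
Unset Strict Implicit.
Unset Printing Implicit Defensive.

Import Order.TTheory GRing.Theory Num.Theory.
Import numFieldNormedType.Exports.

Local Open Scope classical_set_scope.
Local Open Scope ring_scope.

(* With G_p(t) = t^p e_p(1 / (1 - e^(t x))), a power series whose constant
   coefficient is e_p(-1/x), the constant term CTB_p(c) is a polynomial of
   degree p in c, with leading term CTV_p(c).  A finite difference of order p + 1
   of c -> c CTB_p(c) along c = -(l - m) s, 0 <= l <= p + 1, hence retains only
   (p + 1)! CTV_p(s), for any m.  The terms with l > m are those of the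
   right-hand side.  The terms with l < m are brought to the same form by the
   substitution t -> -t: as 1 / (1 - e^(-z)) = 1 - 1 / (1 - e^z), it writes
   CTB_p(c) as a combination of the CTB_j(-c), j <= p.  For m = (n + 1) / 2 both
   halves agree, whence the factor 2 of the odd case. *)

(** * Binomial sums *)

Definition elem_sym {R : pzRingType} {n : nat} (p : nat) (u : 'I_n -> R) : R :=
  \sum_(J : {set 'I_n} | #|J| == p) \prod_(a in J) u a.

Lemma prod_add_mul (R : comPzRingType) (n : nat) (a b : R) (u : 'I_n -> R) :
  \prod_i (a + b * u i) =
  \sum_(j < n.+1) a ^+ (n - j) * b ^+ j * elem_sym j u.
Proof.
under eq_bigr do rewrite addrC.
rewrite bigA_distr (partition_big (fun J : {set 'I_n} => inord #|J| : 'I_n.+1)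
  xpredT) //=.
apply: eq_bigr => j _; rewrite mulr_sumr; apply: eq_big => [J|J /eqP Jj].
  have Jn : (#|J| < n.+1)%N by rewrite ltnS -[leqRHS](card_ord n) max_card.
  by rewrite -(inj_eq val_inj) /= inordK.
have {}Jj : #|J| = j.
  by rewrite -Jj inordK // ltnS -[leqRHS](card_ord n) max_card.
rewrite big_if /= big_split /= !big_const !iter_mulr_1 -Jj.
rewrite [X in a ^+ X](_ : _ = (n - #|J|)%N); first by ring.
rewrite -[X in (X - _)%N](card_ord n) -(cardC (mem J)) addKn.
by apply: eq_card => i.
Qed.

Lemma elem_symE (R : comNzRingType) (n p : nat) (u : 'I_n -> R) : (p <= n)%N ->
  elem_sym p u = (\prod_i (1 + 'X * (u i)%:P))`_p.
Proof.
move=> pn; rewrite prod_add_mul coef_sum.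
have E j : elem_sym j (fun i => (u i)%:P) = (elem_sym j u)%:P.
  by rewrite /elem_sym rmorph_sum; apply: eq_bigr => J _; rewrite rmorph_prod.
rewrite (bigD1 (Ordinal (pn : (p < n.+1)%N))) //= expr1n mul1r E coefMC coefXn.
rewrite eqxx mul1r big1 ?addr0 // => j jp.
rewrite expr1n mul1r E coefMC coefXn.
by rewrite eq_sym [_ == _](negbTE jp) mul0r.
Qed.

Lemma elem_sym_compl (R : comNzRingType) (n p : nat) (u : 'I_n -> R) :
  (p <= n)%N ->
  elem_sym p (fun a => 1 - u a) =
  \sum_(j < p.+1) (-1) ^+ j * 'C(n - j, p - j)%:R * elem_sym j u.
Proof.
move=> pn; rewrite elem_symE //.
rewrite (eq_bigr (fun i => (1 + 'X) + (- 'X) * (u i)%:P)); last first.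
  by move=> i _; rewrite rmorphB rmorph1; ring.
have E j : elem_sym j (fun i => (u i)%:P) = (elem_sym j u)%:P.
  by rewrite /elem_sym rmorph_sum; apply: eq_bigr => J _; rewrite rmorph_prod.
rewrite prod_add_mul coef_sum (big_ord_widen n.+1
  (fun j => (-1) ^+ j * 'C(n - j, p - j)%:R * elem_sym j u)) //.
rewrite [RHS]big_mkcond; apply: eq_bigr => j _; rewrite E coefMC.
rewrite (exprNn 'X) -(rmorph_sign polyC j) mulrCA coefCM coefMXn ltnS.
have binX N k : ((1 + 'X : {poly R}) ^+ N)`_k = 'C(N, k)%:R.
  elim: N k => [|N IHN] k; first by rewrite expr0 coef1 bin0n.
  rewrite exprSr mulrDr mulr1 coefD coefMX !IHN.
  by case: k => [|k]; rewrite ?bin0 ?addr0 // binS natrD.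
by rewrite ltnNge binX; case: leqP => // _; rewrite mulr0 mul0r.
Qed.

Lemma alt_binS (R : pzRingType) (N : nat) (g : nat -> R) :
  \sum_(l < N.+2) (-1) ^+ l * 'C(N.+1, l)%:R * g l =
  \sum_(l < N.+1) (-1) ^+ l * 'C(N, l)%:R * (g l - g l.+1).
Proof.
rewrite big_ord_recl bin0 expr0 !mul1r.
rewrite (eq_bigr (fun l : 'I_N.+1 =>
    (-1) ^+ l.+1 * 'C(N, l.+1)%:R * g l.+1 - (-1) ^+ l * 'C(N, l)%:R * g l.+1));
  last first.
  by move=> l _; rewrite binS natrD exprS mulrDr mulrDl !mulN1r !mulNr.
rewrite sumrB addrA
  [X in X - _](_ : _ = \sum_(l < N.+1) (-1) ^+ l * 'C(N, l)%:R * g l).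
  by rewrite -sumrB; apply: eq_bigr => l _; rewrite mulrBr.
rewrite [RHS]big_ord_recl bin0 expr0 !mul1r; congr (_ + _).
by rewrite big_ord_recr /= bin_small // mulr0 mul0r addr0.
Qed.

Lemma alt_bin_expr (R : comPzRingType) (N k : nat) (c : R) : (k <= N)%N ->
  \sum_(l < N.+1) (-1) ^+ l * 'C(N, l)%:R * (l%:R + c) ^+ k =
  if k == N then (-1) ^+ N * N`!%:R else 0.
Proof.
elim: N k => [|N IHN] k kN.
  by rewrite (eqP (_ : k == 0%N)) -?leqn0 // big_ord1 !mul1r.
rewrite (alt_binS N (fun l => (l%:R + c) ^+ k)).
have -> : \sum_(l < N.+1) (-1) ^+ l * 'C(N, l)%:R *
      ((l%:R + c) ^+ k - (l.+1%:R + c) ^+ k) =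
    - \sum_(j < k) 'C(k, j)%:R * if j == N :> nat then (-1) ^+ N * N`!%:R else 0.
  rewrite -sumrN; under [RHS]eq_bigr => j _.
    rewrite -IHN; last by rewrite -ltnS (leq_trans (ltn_ord j) kN).
    rewrite mulr_sumr -sumrN; over.
  rewrite exchange_big; apply: eq_bigr => l _ /=.
  rewrite [in X in _ * (_ - X)](_ : l.+1%:R + c = 1 + (l%:R + c)); last first.
    by rewrite -natr1; ring.
  rewrite (exprDn 1) big_ord_recr /= subnn expr0 mul1r binn mulr1n opprD addrCA.
  rewrite subrr addr0 mulrN mulr_sumr -sumrN; apply: eq_bigr => j _.
  by rewrite expr1n mul1r -mulr_natl; ring.
case: eqP => [->|/eqP kN1].
  rewrite (bigD1 ord_max) //= eqxx binSn big1 => [|j jN].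
    by rewrite addr0 factS natrM exprS; ring.
  by rewrite (_ : (j == N :> nat) = false) ?mulr0 //; apply: negbTE.
rewrite big1 ?oppr0 // => j _; case: eqP => [jN|]; last by rewrite mulr0.
by move: kN1 (ltn_ord j) kN; rewrite jN; lia.
Qed.

Lemma alt_bin_bin (R : pzRingType) (N a r : nat) :
  \sum_(l < N.+1) (-1) ^+ l * 'C(N, l)%:R * 'C(a + l, r)%:R =
  (if (N <= r)%N then (-1) ^+ N * 'C(a, r - N)%:R else 0) :> R.
Proof.
elim: N r => [|N IHN] r; first by rewrite big_ord1 !mul1r addn0 subn0.
rewrite (alt_binS N (fun l => 'C(a + l, r)%:R)); case: r => [|r].
  by rewrite big1 // => l _; rewrite !bin0 subrr mulr0.
rewrite ltnS subSS exprS -mulrA mulN1r.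
rewrite -[0 in RHS]oppr0 -(fun_if -%R) -IHN -sumrN; apply: eq_bigr => l _.
by rewrite addnS binS natrD opprD addrA subrr sub0r mulrN.
Qed.

Lemma alt_bin_exp_poly (C : fieldType) (p : nat) (G : nat -> C) (m s : C) :
  \sum_(l < p.+2) (-1) ^+ l * 'C(p.+1, l)%:R * (l%:R - m) *
    (\sum_(k < p.+1) (- ((l%:R - m) * s)) ^+ k / k`!%:R * G (p - k)%N) =
  - ((p.+1)`!%:R * (s ^+ p / p`!%:R * G 0)).
Proof.
under eq_bigr do rewrite mulr_sumr.
rewrite exchange_big /=.
under eq_bigr => k _.
  rewrite (eq_bigr (fun l : 'I_p.+2 => (- s) ^+ k / k`!%:R * G (p - k)%N *
    ((-1) ^+ l * 'C(p.+1, l)%:R * (l%:R - m) ^+ k.+1))); last first.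
    by move=> l _; rewrite -mulrN exprMn exprS; ring.
  rewrite -mulr_sumr alt_bin_expr ?ltnS ?leq_ord // eqSS; over.
rewrite big_ord_recr /= subnn eqxx big1 ?add0r => [|k _]; last first.
  by rewrite (ltn_eqF (ltn_ord k)) mulr0.
have sgn2 : (-1) ^+ p * (-1) ^+ p = 1 :> C by rewrite -expr2 sqrr_sign.
rewrite (exprNn s) exprS.
set e := (-1) ^+ p in sgn2 *; set t := s ^+ p / _.
transitivity (- (e * e) * ((p.+1)`!%:R * (t * G 0))); first by rewrite /t; ring.
by rewrite sgn2 mulN1r.
Qed.

Lemma signr_subn (R : pzRingType) (n p : nat) : (p <= n)%N ->
  (-1) ^+ (n - p) = (-1) ^+ n * (-1) ^+ p :> R.
Proof.
by move=> pn; rewrite -[in RHS](subnK pn) exprD -mulrA -expr2 sqrr_sign mulr1.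
Qed.

Lemma alt_bin_bin_compl (R : comPzRingType) (n m i j : nat) :
    (i <= m)%N -> (m <= n.+1)%N -> (j <= n)%N ->
  \sum_(j <= p < n.+1) (-1) ^+ p * 'C(p.+1, m - i)%:R * 'C(n - j, p - j)%:R =
  (-1) ^+ n * 'C(j.+1, n.+1 - m + i)%:R :> R.
Proof.
move=> im mn jn; rewrite -{1}[j]add0n big_addn big_mkord subSn //.
rewrite (eq_bigr (fun l : 'I_(n - j).+1 => (-1) ^+ j *
    ((-1) ^+ l * 'C(n - j, l)%:R * 'C(j.+1 + l, m - i)%:R))); last first.
  move=> l _; rewrite addnK exprD addSn [(j + l)%N]addnC; ring.
rewrite -mulr_sumr alt_bin_bin; case: leqP => jm.
  rewrite mulrA -exprD subnKC // -bin_sub; last by lia.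
  by congr (_ * 'C(_, _)%:R); lia.
by rewrite mulr0 bin_small ?mulr0 //; lia.
Qed.

Lemma sum_split_center (V : nmodType) (m N : nat) (h : nat -> V) : h m = 0 ->
  \sum_(0 <= l < m + N.+1) h l =
  \sum_(1 <= i < N.+1) h (m + i)%N + \sum_(1 <= i < m.+1) h (m - i)%N.
Proof.
move=> hm; rewrite (big_cat_nat (n := m)) ?leq_addr //= addrC.
congr (_ + _).
  rewrite big_ltn ?hm ?add0r; last by rewrite addnS ltnS leq_addr.
  by rewrite -{1}[m.+1]add1n big_addn addKn; apply: eq_bigr => i _; rewrite addnC.
rewrite big_nat_rev big_add1 /=; apply: eq_big_nat => l _.
by rewrite add0n.
Qed.

(* The index l = m + i of the finite difference runs over i >= 1 to the right
   of m; the hypothesis FN folds the indices l = m - i onto those. *)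
Lemma bin_reflection_identity (C : fieldType) (n m : nat) (s : C)
    (F : nat -> C -> C) (G : nat -> nat -> C) :
    (m <= n.+1)%N ->
    (forall p c, (p <= n)%N ->
      F p c = \sum_(k < p.+1) c ^+ k / k`!%:R * G p (p - k)%N) ->
    (forall p c, (p <= n)%N ->
      F p c = \sum_(j < p.+1) (-1) ^+ j * 'C(n - j, p - j)%:R * F j (- c)) ->
  \sum_(0 <= p < n.+1)
    (-1) ^+ (n - p) * (p.+1)`!%:R * (s ^+ p / p`!%:R * G p 0) =
  (-1) ^+ n * \sum_(0 <= j < n.+1) (-1) ^+ j.+1 * \sum_(1 <= i < n.+2)
    (-1) ^+ (m + i) *
    ('C(j.+1, m + i)%:R + (-1) ^+ n.+1 * 'C(j.+1, n.+1 - m + i)%:R) * i%:R *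
    F j (- (i%:R * s)).
Proof.
move=> mn FE FN.
pose h p l : C := (-1) ^+ l * 'C(p.+1, l)%:R * (l%:R - m%:R) *
  F p (- ((l%:R - m%:R) * s)).
have hE p : (p <= n)%N ->
    (p.+1)`!%:R * (s ^+ p / p`!%:R * G p 0) =
    - (\sum_(1 <= i < n.+2) h p (m + i)%N + \sum_(1 <= i < m.+1) h p (m - i)%N).
  move=> pn; rewrite -sum_split_center; last by rewrite /h subrr mulr0 mul0r.
  rewrite (big_cat_nat (n := p.+2)) ?leq0n //=; last by lia.
  rewrite [X in _ + X]big1_seq ?addr0 => [|l]; last first.
    rewrite mem_index_iota => /andP[_ /andP[pl _]].
    by rewrite /h bin_small // mulr0 !mul0r.
  rewrite big_mkord -[LHS]opprK -(alt_bin_exp_poly p (G p) m%:R); congr (- _).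
  by apply: eq_bigr => l _; rewrite /h FE.
transitivity ((-1) ^+ n * \sum_(0 <= p < n.+1) (-1) ^+ p.+1 *
    (\sum_(1 <= i < n.+2) h p (m + i)%N + \sum_(1 <= i < m.+1) h p (m - i)%N)).
  rewrite mulr_sumr; apply: eq_big_nat => p /andP[_ pn].
  by rewrite -mulrA hE // signr_subn // (exprS (-1) p) mulN1r mulNr !mulrN mulrA.
congr (_ * _); rewrite (eq_bigr _ (fun p _ => mulrDr _ _ _)) big_split /=.
rewrite [RHS](eq_bigr (fun j =>
    (-1) ^+ j.+1 * (\sum_(1 <= i < n.+2) h j (m + i)%N) +
    (-1) ^+ n * \sum_(1 <= i < n.+2) (-1) ^+ (m + i + j) *
      'C(j.+1, n.+1 - m + i)%:R * i%:R * F j (- (i%:R * s))));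
  last first.
  move=> j _; rewrite !mulr_sumr -big_split /=; apply: eq_bigr => i _.
  rewrite /h (_ : (m + i)%:R - m%:R = i%:R); last by rewrite natrD addrC addKr.
  by rewrite !exprD (exprS _ n) (exprS _ j); ring.
rewrite big_split /=; congr (_ + _).
rewrite -mulr_sumr; under eq_bigr do rewrite mulr_sumr.
rewrite exchange_big_nat [in RHS]exchange_big_nat /=.
rewrite [in RHS](big_cat_nat (n := m.+1)) //=.
rewrite [X in _ + X]big1_seq ?addr0 => [|i]; last first.
  rewrite mem_index_iota => /andP[_ /andP[mi _]].
  rewrite big1_seq // => j; rewrite mem_index_iota => /andP[_ /andP[_ jn]].
  by rewrite bin_small ?mulr0 ?mul0r //; lia.
rewrite mulr_sumr; apply: eq_big_nat => i /andP[i_gt0 im].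
have imn : (m - i)%:R - m%:R = - i%:R :> C.
  by rewrite natrB // addrAC subrr add0r.
transitivity (\sum_(0 <= p < n.+1) \sum_(0 <= j < n.+1 | (j < p.+1)%N)
    (-1) ^+ (m + i + j) * ((-1) ^+ p * 'C(p.+1, m - i)%:R * 'C(n - j, p - j)%:R) *
    (i%:R * F j (- (i%:R * s)))).
  apply: eq_big_nat => p /andP[_ pn].
  rewrite /h imn mulNr opprK FN // exprS.
  rewrite -(big_mkord xpredT (fun j => (-1) ^+ j * 'C(n - j, p - j)%:R *
    F j (- (i%:R * s)))) (big_nat_widen _ p.+1 n.+1) // mulr_sumr mulr_sumr.
  apply: eq_bigr => j _; rewrite !exprD.
  rewrite [(-1) ^+ (m - i)]signr_subn //; ring.
rewrite (exchange_big_dep_nat xpredT) //= mulr_sumr.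
apply: eq_big_nat => j /andP[_ jn]; rewrite -mulr_suml -mulr_sumr.
rewrite -(big_nat_widenl j 0 n.+1 xpredT) // alt_bin_bin_compl //; ring.
Qed.

Lemma sum_bin_range (R : pzRingType) (n m : nat) (a : nat -> R)
    (f : nat -> nat -> R) :
    (m <= n.+1)%N ->
    (forall p i, (p.+1 < m + i)%N -> f p i = 0) ->
  \sum_(m <= p < n.+1) a p * \sum_(1 <= i < (p.+1 - m).+1) f p i =
  \sum_(0 <= p < n.+1) a p * \sum_(1 <= i < n.+2) f p i.
Proof.
move=> mn f0; rewrite [RHS](big_cat_nat (n := m)) //=.
rewrite [X in X + _]big1_seq ?add0r => [|p]; last first.
  rewrite mem_index_iota => /andP[_ /andP[_ pm]].
  rewrite big1_seq ?mulr0 // => i; rewrite mem_index_iota => /andP[_ i_gt0].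
  by rewrite f0 //; lia.
apply: eq_big_nat => p /andP[mp pn]; congr (_ * _).
rewrite [RHS](big_cat_nat (n := (p.+1 - m).+1)) //=; last by lia.
rewrite [X in _ + X]big1_seq ?addr0 // => i.
by rewrite mem_index_iota => /andP[_ i_gt0]; rewrite f0 //; lia.
Qed.

Lemma bin_reflection_parity (C : fieldType) (n : nat) (s : C)
    (F : nat -> C -> C) (G : nat -> nat -> C) :
    (forall p c, (p <= n)%N ->
      F p c = \sum_(k < p.+1) c ^+ k / k`!%:R * G p (p - k)%N) ->
    (forall p c, (p <= n)%N ->
      F p c = \sum_(j < p.+1) (-1) ^+ j * 'C(n - j, p - j)%:R * F j (- c)) ->
  let lhs := \sum_(0 <= p < n.+1)
    (-1) ^+ (n - p) * (p.+1)`!%:R * (s ^+ p / p`!%:R * G p 0) in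
  (odd n -> lhs = \sum_(n.+1./2 <= p < n.+1) (-1) ^+ p *
    \sum_(1 <= i < (p.+1 - n.+1./2).+1)
      (-1) ^+ (n.+1./2 - i) * 'C(p.+1, n.+1./2 + i)%:R * 2 * i%:R *
      F p (- (i%:R * s)))
  /\ (~~ odd n -> lhs = \sum_(n./2 <= p < n.+1) (-1) ^+ p *
    \sum_(1 <= i < (p.+1 - n./2).+1)
      (-1) ^+ (n./2.+1 - i) *
      ('C(p.+1, n./2 + i)%:R - 'C(p.+1, (n./2 + i).+1)%:R) * i%:R *
      F p (- (i%:R * s))).
Proof.
move=> FE FN lhs; split=> n_odd.
  have nm : n.+1 = (n.+1./2 + n.+1./2)%N.
    by rewrite addnn -[LHS]odd_double_half /= n_odd.
  have mn : (n.+1./2 <= n.+1)%N by lia.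
  rewrite sum_bin_range // => [|p i ?]; last by rewrite bin_small // mulr0 !mul0r.
  rewrite /lhs (bin_reflection_identity s mn FE FN) mulr_sumr.
  apply: eq_big_nat => p /andP[_ pn]; rewrite !mulr_sumr; apply: eq_bigr => i _.
  rewrite (_ : (n.+1 - n.+1./2)%N = n.+1./2); last by lia.
  rewrite -!(signr_odd _ n) n_odd [(-1) ^+ n.+1]exprS -!(signr_odd _ n) n_odd.
  case: (leqP i n.+1./2) => im; first by rewrite signr_subn // exprD exprS; ring.
  by rewrite bin_small; [ring|lia].
have nm : n = (n./2 + n./2)%N.
  by rewrite addnn -[LHS]odd_double_half (negbTE n_odd).
have mn : (n./2 <= n.+1)%N by lia.
rewrite sum_bin_range // => [|p i ?]; last first.
  by rewrite !bin_small ?subrr ?mulr0 ?mul0r // ltnW // ltnS ltnW.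
rewrite /lhs (bin_reflection_identity s mn FE FN) mulr_sumr.
apply: eq_big_nat => p /andP[_ pn]; rewrite !mulr_sumr; apply: eq_bigr => i _.
rewrite (_ : (n.+1 - n./2 + i)%N = (n./2 + i).+1); last by lia.
rewrite -!(signr_odd _ n) [(-1) ^+ n.+1]exprS -!(signr_odd _ n) (negbTE n_odd).
case: (leqP i n./2.+1) => im.
  by rewrite signr_subn // exprD 2!exprS; ring.
by rewrite !bin_small; [ring|lia|lia].
Qed.

(** * Power series with geometrically bounded coefficients *)

Definition geom_bounded {C : numDomainType} (a : nat -> C) : Prop :=
  exists r : C, forall k, `|a k| <= r ^+ k.+1.

Definition cauchy_prod {C : pzRingType} (a b : nat -> C) (k : nat) : C :=
  \sum_(i < k.+1) a i * b (k - i)%N.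

(* A geometric bound on the coefficients plays the role of a positive radius of
   convergence: all limits are then obtained as limits of partial sums, so that
   the completeness of C is never needed. *)
Definition is_ps {C : numFieldType} (f : C -> C) (a : nat -> C) : Prop :=
  geom_bounded a /\
  \forall t \near 0^', series (fun k => a k * t ^+ k) @ \oo --> f t.

Lemma geom_boundedP (C : numDomainType) (a : nat -> C) :
  geom_bounded a -> exists r, [/\ 0 <= r & forall k, `|a k| <= r ^+ k.+1].
Proof.
by case=> r ar; exists r; split=> //; rewrite -[r]expr1 (le_trans _ (ar 0%N)).
Qed.

Lemma geom_bounded_const (C : numFieldType) (a : nat -> C) (K r : C) :
  0 <= K -> 0 <= r -> (forall k, `|a k| <= K * r ^+ k) -> geom_bounded a.
Proof.
move=> K0 r0 ar; exists (K + r) => k; rewrite exprS.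
apply: (le_trans (ar k)); apply: ler_pM => //; first exact: exprn_ge0.
  by rewrite lerDl.
by apply: lerXn2r; rewrite ?nnegrE ?addr_ge0 ?lerDr.
Qed.

Lemma geom_boundedD (C : numFieldType) (a b : nat -> C) :
  geom_bounded a -> geom_bounded b -> geom_bounded (fun k => a k + b k).
Proof.
move=> /geom_boundedP[r [r0 ar]] /geom_boundedP[s [s0 bs]].
exists (r + s) => k; apply: (le_trans (ler_normD _ _)).
apply: (le_trans (lerD (ar k) (bs k))); rewrite 3!exprS mulrDl.
by apply: lerD; rewrite ler_wpM2l // lerXn2r ?nnegrE ?addr_ge0 ?lerDl ?lerDr.
Qed.

Lemma geom_boundedZ (C : numFieldType) (c : C) (a : nat -> C) :
  geom_bounded a -> geom_bounded (fun k => c * a k).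
Proof.
move=> /geom_boundedP[r [r0 ar]].
apply: (@geom_bounded_const _ _ (`|c| * r) r) => //; first exact: mulr_ge0.
by move=> k; rewrite normrM -mulrA -exprS ler_wpM2l.
Qed.

Lemma cauchy_prod_le (C : numDomainType) (a b : nat -> C) (r : C) :
    (forall k, `|a k| <= r ^+ k.+1) -> (forall k, `|b k| <= r ^+ k.+1) ->
  forall k, `|cauchy_prod a b k| <= k.+1%:R * r ^+ k.+2.
Proof.
move=> ar br k; apply: (le_trans (ler_norm_sum _ _ _)).
have -> : k.+1%:R * r ^+ k.+2 = \sum_(i < k.+1) r ^+ k.+2.
  by rewrite sumr_const card_ord mulr_natl.
apply: ler_sum => i _.
rewrite normrM (_ : k.+2 = i.+1 + (k - i).+1)%N; last by have := ltn_ord i; lia.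
by rewrite exprD ler_pM.
Qed.

Lemma natr_le_exp2 (C : numDomainType) (k : nat) : k%:R <= 2 ^+ k :> C.
Proof. by rewrite -natrX ler_nat ltnW // ltn_expl. Qed.

Lemma geom_bounded_common (C : numFieldType) (a b : nat -> C) :
  geom_bounded a -> geom_bounded b ->
  exists r, [/\ 0 <= r, forall k, `|a k| <= r ^+ k.+1 &
                forall k, `|b k| <= r ^+ k.+1].
Proof.
move=> /geom_boundedP[r [r0 ar]] /geom_boundedP[s [s0 bs]].
exists (r + s); split=> [|k|k]; first exact: addr_ge0.
  by apply: (le_trans (ar k)); rewrite lerXn2r ?nnegrE ?addr_ge0 ?lerDl.
by apply: (le_trans (bs k)); rewrite lerXn2r ?nnegrE ?addr_ge0 ?lerDr.
Qed.

Lemma geom_bounded_cauchy_prod (C : numFieldType) (a b : nat -> C) :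
  geom_bounded a -> geom_bounded b -> geom_bounded (cauchy_prod a b).
Proof.
move=> ga gb; have [r [r0 ar br]] := geom_bounded_common ga gb.
apply: (@geom_bounded_const _ _ (2 * r ^+ 2) (2 * r)).
- by rewrite mulr_ge0 ?exprn_ge0.
- by rewrite mulr_ge0.
move=> k; apply: (le_trans (cauchy_prod_le ar br k)).
rewrite exprMn mulrACA -exprS -exprD add2n ler_wpM2r ?exprn_ge0 //.
exact: natr_le_exp2.
Qed.

Lemma geom_bounded_shift (C : numFieldType) (a : nat -> C) (m : nat) :
  geom_bounded a -> geom_bounded (fun k => a (m + k)%N).
Proof.
move=> /geom_boundedP[r [r0 ar]].
apply: (@geom_bounded_const _ _ (r ^+ m.+1) r) => //; first exact: exprn_ge0.
by move=> k; rewrite -exprD addSn.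
Qed.

Fixpoint inv_coefs {C : fieldType} (a : nat -> C) (n : nat) : seq C :=
  if n is k.+1 then
    rcons (inv_coefs a k)
      (((k == 0)%:R - \sum_(i < k) (inv_coefs a k)`_i * a (k - i)%N) / a 0)
  else [::].

Lemma cauchy_inverse (C : fieldType) (a : nat -> C) : a 0 != 0 ->
  exists b, cauchy_prod b a =1 (fun k => (k == 0)%:R).
Proof.
move=> a0; have sz n : size (inv_coefs a n) = n.
  by elim: n => //= n IHn; rewrite size_rcons IHn.
pose b k := (inv_coefs a k.+1)`_k; exists b => k.
have nthb n i : (i < n)%N -> (inv_coefs a n)`_i = b i.
  elim: n => // n IHn; rewrite ltnS leq_eqVlt => /predU1P[-> //|i_n].
  by rewrite /= nth_rcons sz i_n IHn.
rewrite /cauchy_prod big_ord_recr /= subnn.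
rewrite {2}/b /= nth_rcons sz ltnn eqxx mulfVK // addrC.
under [X in _ - X + _]eq_bigr do rewrite nthb //.
by rewrite subrK.
Qed.

Lemma geom_bounded_inverse (C : numFieldType) (a b : nat -> C) :
    a 0 != 0 -> geom_bounded a -> cauchy_prod b a =1 (fun k => (k == 0)%:R) ->
  geom_bounded b.
Proof.
move=> a0 /geom_boundedP[r [r0 ar]] ba.
have na0 : 0 < `|a 0| by rewrite normr_gt0.
pose s := r * (r / `|a 0| + 1).
have ra0 : 0 <= r / `|a 0| by rewrite divr_ge0.
have s0 : 0 <= s by rewrite mulr_ge0 // addr_ge0.
have as_ j : (0 < j)%N -> `|a j| / `|a 0| <= s ^+ j.
  move=> j0; apply: (@le_trans _ _ (r ^+ j * (r / `|a 0|))).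
    by rewrite mulrA -exprSr ler_wpM2r ?invr_ge0.
  rewrite exprMn ler_wpM2l ?exprn_ge0 //.
  apply: (@le_trans _ _ (r / `|a 0| + 1)); first by rewrite lerDl.
  by rewrite -[leLHS]expr1 ler_weXn2l // lerDr.
apply: (@geom_bounded_const _ _ `|a 0|^-1 (2 * s)).
- by rewrite invr_ge0.
- by rewrite mulr_ge0.
elim/ltn_ind => k IHk; have := ba k.
rewrite /cauchy_prod big_ord_recr /= subnn => /(canRL (addKr _)) bk.
have {bk} -> : b k = ((k == 0)%:R - \sum_(i < k) b i * a (k - i)%N) / a 0.
  by rewrite addrC -bk mulfK.
case: k IHk => [|k] IHk.
  by rewrite big_ord0 subr0 eqxx mul1r expr0 mulr1 normfV.
rewrite /= sub0r mulNr normrN mulr_suml; apply: (le_trans (ler_norm_sum _ _ _)).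
apply: (@le_trans _ _ (\sum_(i < k.+1) (`|a 0|^-1 * s ^+ k.+1) * 2 ^+ i)).
  apply: ler_sum => i _.
  have -> : `|b i * a (k.+1 - i)%N / a 0| =
      `|b i| * (`|a (k.+1 - i)%N| / `|a 0|).
    by rewrite !normrM normfV mulrA.
  have ik : (0 < k.+1 - i)%N by rewrite subn_gt0.
  apply: (@le_trans _ _ (`|a 0|^-1 * (2 * s) ^+ i * s ^+ (k.+1 - i))).
    apply: ler_pM; rewrite ?mulr_ge0 ?invr_ge0 //; last exact: as_.
    exact: IHk.
  have -> : s ^+ k.+1 = s ^+ (k.+1 - i) * s ^+ i.
    by rewrite -exprD subnK // ltnW.
  rewrite exprMn.
  by rewrite le_eqVlt; apply/orP; left; apply/eqP; ring.
rewrite -mulr_sumr.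
have -> : `|a 0|^-1 * (2 * s) ^+ k.+1 = (`|a 0|^-1 * s ^+ k.+1) * 2 ^+ k.+1.
  by rewrite exprMn mulrCA mulrC.
rewrite ler_wpM2l ?mulr_ge0 ?invr_ge0 ?exprn_ge0 //.
have -> : 2 ^+ k.+1 = 1 + \sum_(i < k.+1) 2 ^+ i :> C.
  by rewrite -[LHS](subrK 1) subrX1 addrC (natrD _ 1 1) addrK mul1r.
by rewrite lerDr.
Qed.

Section PowerSeries.
Context (C : numFieldType).
Context (half0 : (fun n => 2^-1 ^+ n : C) @ \oo --> (0 : C)).

Lemma squeeze0 (u v : nat -> C) :
  (forall n, `|u n| <= v n) -> v @ \oo --> (0 : C) -> u @ \oo --> (0 : C).
Proof.
move=> uv /cvgr0Pnorm_lt v0; apply/cvgr0Pnorm_lt => e /v0.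
apply: filterS => n; apply: le_lt_trans.
by rewrite (le_trans (uv n)) // real_ler_norm // realE (le_trans _ (uv n)).
Qed.

Lemma eq_cvgn (u v : nat -> C) (l : C) :
  u =1 v -> v @ \oo --> l -> u @ \oo --> l.
Proof. by move=> /funext ->. Qed.

Lemma seriesE (a : nat -> C) (t : C) (n : nat) :
  series (fun k => a k * t ^+ k) n = (\poly_(k < n) a k).[t].
Proof. by rewrite horner_poly /series /= big_mkord. Qed.

(* The difference is the value at t of a polynomial whose coefficients of index
   below n vanish. *)
Lemma cauchy_prod_series_sub (a b : nat -> C) (r t : C) :
    0 <= r -> (forall k, `|a k| <= r ^+ k.+1) ->
    (forall k, `|b k| <= r ^+ k.+1) -> r * `|t| <= 8^-1 ->
  (fun n => series (fun k => a k * t ^+ k) n * series (fun k => b k * t ^+ k) n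
    - series (fun k => cauchy_prod a b k * t ^+ k) n) @ \oo --> (0 : C).
Proof.
move=> r0 ar br rt.
apply: (@squeeze0 _ (fun n => (2 * r ^+ 2) * 2^-1 ^+ n)); last first.
  rewrite -[X in _ --> X](mulr0 (2 * r ^+ 2)).
  by apply: cvgM => //; exact: cvg_cst.
move=> n; rewrite !seriesE -hornerM -hornerN -hornerD.
set D := (X in X.[t]).
have Dlo k : (k < n)%N -> D`_k = 0.
  move=> kn; rewrite coefB coefM coef_poly kn; apply/eqP; rewrite subr_eq0.
  apply/eqP; apply: eq_bigr => i _.
  by rewrite !coef_poly !(leq_ltn_trans _ kn) ?leq_subr ?leq_ord.
have Dhi k : (n <= k)%N -> `|D`_k| <= k.+1%:R * r ^+ k.+2.
  move=> nk; rewrite coefB [X in _ - X]coef_poly ltnNge nk subr0.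
  have tr c : (forall k, `|c k| <= r ^+ k.+1) ->
      forall k, `|(\poly_(k < n) c k)`_k| <= r ^+ k.+1.
    by move=> cr j; rewrite coef_poly; case: ifP => // _; rewrite normr0 exprn_ge0.
  by rewrite coefM; exact: (cauchy_prod_le (tr _ ar) (tr _ br)).
have sD : (size D <= n + n)%N.
  rewrite (leq_trans (size_polyD _ _)) // geq_max size_polyN.
  rewrite (leq_trans (size_poly _ _)) ?leq_addr ?andbT //.
  rewrite (leq_trans (size_polyMleq _ _)) // (leq_trans (leq_pred _)) //.
  by rewrite leq_add ?size_poly.
rewrite (horner_coef_wide _ sD); apply: (le_trans (ler_norm_sum _ _ _)).
have term k : `|D`_k * t ^+ k| <= r ^+ 2 * (4^-1) ^+ n.
  case: (ltnP k n) => [/Dlo ->|nk].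
    by rewrite mul0r normr0 mulr_ge0 ?exprn_ge0 // invr_ge0.
  rewrite normrM normrX; apply: (le_trans (ler_wpM2r _ (Dhi _ nk))).
    exact: exprn_ge0.
  have -> : k.+1%:R * r ^+ k.+2 * `|t| ^+ k =
      r ^+ 2 * (k.+1%:R * (r * `|t|) ^+ k) by rewrite exprMn !exprS; ring.
  rewrite ler_wpM2l ?exprn_ge0 //.
  apply: (@le_trans _ _ (2 ^+ k * 8^-1 ^+ k)).
    apply: ler_pM => //; first by rewrite exprn_ge0 // mulr_ge0.
      by rewrite -natrX ler_nat ltn_expl.
    by rewrite lerXn2r ?nnegrE ?mulr_ge0 // invr_ge0.
  rewrite -exprMn (_ : 2 / 8 = 4^-1); last by field.
  by rewrite ler_wiXn2l // ?invr_ge0 // invf_le1 // ler1n.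
apply: (@le_trans _ _ (\sum_(i < n + n) r ^+ 2 * 4^-1 ^+ n)).
  by apply: ler_sum => i _; exact: term.
rewrite sumr_const card_ord -[_ *+ (n + n)]mulr_natl.
have -> : (n + n)%:R * (r ^+ 2 * 4^-1 ^+ n) =
    (2 * r ^+ 2 * 2^-1 ^+ n) * (n%:R * 2^-1 ^+ n).
  by rewrite (_ : 4^-1 = 2^-1 * 2^-1) ?exprMn ?natrD; [ring|field].
rewrite ler_piMr ?mulr_ge0 ?exprn_ge0 ?invr_ge0 //.
by rewrite exprVn ler_pdivrMr ?exprn_gt0 // mul1r natr_le_exp2.
Qed.

Lemma near0_mul_le (r e : C) : 0 <= r -> 0 < e ->
  \forall t \near (0 : C)^', r * `|t| <= e.
Proof.
move=> r0 e0; have r1 : 0 < r + 1 by rewrite ltr_wpDl.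
near=> t; apply: (@le_trans _ _ ((r + 1) * `|t|)).
  by rewrite ler_wpM2r // lerDl.
rewrite mulrC -ler_pdivlMr //; apply: ltW; near: t.
by apply: dnbhs0_lt; rewrite divr_gt0.
Unshelve. all: by end_near. Qed.

Lemma is_psM (f g : C -> C) (a b : nat -> C) :
  is_ps f a -> is_ps g b -> is_ps (fun t => f t * g t) (cauchy_prod a b).
Proof.
move=> [ga fa] [gb fb]; split; first exact: geom_bounded_cauchy_prod.
have [r [r0 ar br]] := geom_bounded_common ga gb.
near=> t.
have At : series (fun k => a k * t ^+ k) @ \oo --> f t by near: t.
have Bt : series (fun k => b k * t ^+ k) @ \oo --> g t by near: t.
have rt : r * `|t| <= 8^-1 by near: t; apply: (near0_mul_le r0); rewrite invr_gt0.
rewrite -[f t * g t]subr0.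
apply: (eq_cvgn _ (cvgB (cvgM At Bt) (cauchy_prod_series_sub r0 ar br rt))).
by move=> n /=; rewrite opprB addrC subrK.
Unshelve. all: by end_near. Qed.

Lemma near0P (P : C -> Prop) : (\forall t \near (0 : C)^', P t) <->
  exists e : C, 0 < e /\ forall t, 0 < `|t| < e -> P t.
Proof.
split=> [|[e [e0 eP]]].
  rewrite /dnbhs near_withinE => /nbhs_norm0P[e /= e0 eP].
  exists e; split=> // t /andP[t0 te]; apply: (eP t) => //=.
  by rewrite -normr_gt0.
have ? : \forall t \near (0 : C), t != 0 -> P t.
  apply/nbhs_norm0P; exists e => //= t te /= t0.
  by apply: eP; rewrite normr_gt0 t0 te.
by rewrite /dnbhs near_withinE.
Qed.

Lemma is_ps_near (f g : C -> C) (a : nat -> C) :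
  (\forall t \near (0 : C)^', f t = g t) -> is_ps f a -> is_ps g a.
Proof.
move=> fg [ga fa]; split=> //; near=> t.
by have <- : f t = g t; near: t.
Unshelve. all: by end_near. Qed.

Lemma near0_neq0 : \forall t \near (0 : C)^', t != 0.
Proof. by apply/near0P; exists 1; split=> // t; rewrite normr_gt0 => /andP[]. Qed.

Lemma cvg_addn (N : nat) (u : nat -> C) (l : C) :
  (fun n => u (n + N)%N) @ \oo --> l <-> u @ \oo --> l.
Proof. by rewrite -(cvg_shiftn N u (nbhs l)). Qed.

Lemma is_psD (f g : C -> C) (a b : nat -> C) :
  is_ps f a -> is_ps g b -> is_ps (fun t => f t + g t) (fun k => a k + b k).
Proof.
move=> [ga fa] [gb fb]; split; first exact: geom_boundedD.
near=> t.
have At : series (fun k => a k * t ^+ k) @ \oo --> f t by near: t.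
have Bt : series (fun k => b k * t ^+ k) @ \oo --> g t by near: t.
apply: (eq_cvgn _ (cvgD At Bt)) => n /=.
rewrite fctE !seriesE !horner_poly -big_split.
by apply: eq_bigr => i _; rewrite mulrDl.
Unshelve. all: by end_near. Qed.

Lemma is_psZ (f : C -> C) (c : C) (a : nat -> C) :
  is_ps f a -> is_ps (fun t => c * f t) (fun k => c * a k).
Proof.
move=> [ga fa]; split; first exact: geom_boundedZ.
near=> t.
have At : series (fun k => a k * t ^+ k) @ \oo --> f t by near: t.
apply: (eq_cvgn _ (cvgM (cvg_cst c) At)) => n /=.
by rewrite !seriesE !horner_poly mulr_sumr; apply: eq_bigr => i _; rewrite mulrA.
Unshelve. all: by end_near. Qed.

Lemma is_ps_Xn (m : nat) : is_ps (fun t : C => t ^+ m) (fun k => (k == m)%:R).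
Proof.
split.
  exists 1 => k; rewrite expr1n; case: eqP => _; by rewrite ?normr1 ?normr0.
near=> t; apply/(cvg_addn m.+1).
apply: (eq_cvgn _ (cvg_cst (t ^+ m))) => n /=.
rewrite seriesE horner_poly.
rewrite (bigD1 (Ordinal (ltn_addl n (ltnSn m)))) //= eqxx mul1r.
by rewrite big1 ?addr0 // => i im; rewrite (negbTE (im : i != m :> nat)) mul0r.
Unshelve. all: by end_near. Qed.

Lemma is_ps_opp (f : C -> C) (a : nat -> C) :
  is_ps f a -> is_ps (fun t => f (- t)) (fun k => (-1) ^+ k * a k).
Proof.
move=> [[r ar] /near0P[e [e0 ef]]]; split.
  by exists r => k; rewrite normrM normrX normrN1 expr1n mul1r.
apply/near0P; exists e; split=> // t te.
rewrite -normrN in te; apply: (eq_cvgn _ (ef _ te)) => n.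
rewrite !seriesE !horner_poly; apply: eq_bigr => i _.
by rewrite (exprNn t) mulrCA mulrA.
Qed.

Lemma is_ps_divXn (f : C -> C) (a : nat -> C) (m : nat) :
    (forall k, (k < m)%N -> a k = 0) -> is_ps f a ->
  is_ps (fun t => f t / t ^+ m) (fun k => a (m + k)%N).
Proof.
move=> am [ga fa]; split; first exact: geom_bounded_shift.
near=> t.
have At : series (fun k => a k * t ^+ k) @ \oo --> f t by near: t.
have t0 : t != 0 by near: t; exact: near0_neq0.
have {}At := proj2 (cvg_addn m _ _) At.
apply: (eq_cvgn _ (cvgM At (cvg_cst (t ^+ m)^-1))) => n /=.
rewrite !seriesE !horner_poly [(n + m)%N]addnC big_split_ord /=.
rewrite [X in (X + _) * _]big1 ?add0r => [|i _]; last first.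
  by rewrite (am _ (ltn_ord i)) mul0r.
rewrite mulr_suml; apply: eq_bigr => i _.
by rewrite exprD mulrA mulrAC mulfK // expf_neq0.
Unshelve. all: by end_near. Qed.

Lemma geom_half (n : nat) : \sum_(i < n) 2^-1 ^+ i = 2 - 2 * 2^-1 ^+ n :> C.
Proof.
elim: n => [|n IHn]; first by rewrite big_ord0 mulr1 subrr.
by rewrite big_ord_recr /= IHn exprS; field.
Qed.

Lemma bounded_mul_cvg0 (u v : nat -> C) (K : C) : (forall n, `|u n| <= K) ->
  v @ \oo --> (0 : C) -> (fun n => u n * v n) @ \oo --> (0 : C).
Proof.
move=> uK v0; apply: (@squeeze0 _ (fun n => K * `|v n|)) => [n|].
  by rewrite normrM ler_wpM2r.
rewrite -[X in _ --> X](mulr0 K); apply: cvgM; first exact: cvg_cst.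
by rewrite -[X in _ --> X](normr0 C); exact: cvg_norm.
Qed.

(* If f t = 0, the product of the partial sums of f and of its inverse series
   tends both to 1 and, the latter being bounded, to 0. *)
Lemma is_psV (f : C -> C) (a : nat -> C) : a 0%N != 0 -> is_ps f a ->
  (\forall t \near (0 : C)^', f t != 0) /\
  exists b, is_ps (fun t => (f t)^-1) b /\ b 0%N = (a 0%N)^-1.
Proof.
move=> a0 [ga fa]; have [b ba] := cauchy_inverse a0.
have gb := geom_bounded_inverse a0 ga ba.
have b0 : b 0 = (a 0)^-1.
  by apply: (mulIf a0); rewrite mulVf // -[RHS](ba 0) /cauchy_prod big_ord1.
have [r [r0 br ar]] := geom_bounded_common gb ga.
have main : \forall t \near (0 : C)^', f t != 0 /\
    series (fun k => b k * t ^+ k) @ \oo --> (f t)^-1.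
  near=> t.
  have At : series (fun k => a k * t ^+ k) @ \oo --> f t by near: t.
  have rt : r * `|t| <= 8^-1 by near: t; apply: (near0_mul_le r0); rewrite invr_gt0.
  pose A := series (fun k => a k * t ^+ k).
  pose B := series (fun k => b k * t ^+ k).
  have BA : (fun n => B n * A n) @ \oo --> (1 : C).
    have D0 := cauchy_prod_series_sub r0 br ar rt.
    have {}D0 := proj2 (cvg_addn 1 _ _) D0.
    apply/(cvg_addn 1); rewrite -[1 : C]addr0.
    apply: (eq_cvgn _ (cvgD (cvg_cst (1 : C)) D0)) => n /=.
    rewrite fctE [X in _ - X]seriesE horner_poly addn1 big_ord_recl ba mul1r expr0.
    rewrite big1 ?addr0 => [|i _]; last by rewrite ba mul0r.
    by rewrite addrC subrK.
  have Bbd n : `|B n| <= 2 * r.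
    apply: (@le_trans _ _ (r * \sum_(i < n) 2^-1 ^+ i)).
      rewrite /B seriesE horner_poly (le_trans (ler_norm_sum _ _ _)) //.
      rewrite mulr_sumr; apply: ler_sum => i _; rewrite normrM normrX.
      apply: (le_trans (ler_wpM2r _ (br i))); first exact: exprn_ge0.
      rewrite exprS -mulrA -exprMn ler_wpM2l //.
      rewrite lerXn2r ?nnegrE ?mulr_ge0 ?invr_ge0 // (le_trans rt) //.
      by rewrite lef_pV2 ?posrE // ler_nat.
    by rewrite mulrC ler_wpM2r // geom_half gerBl mulr_ge0 ?exprn_ge0 ?invr_ge0.
  have ft0 : f t != 0.
    apply/eqP => ft0; rewrite /= ft0 in At.
    have := bounded_mul_cvg0 Bbd At.
    by move=> /(norm_cvg_unique BA)/eqP; rewrite oner_eq0.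
  split=> //.
  have ftA : (fun n => f t - A n) @ \oo --> (0 : C).
    by rewrite -[X in _ --> X](subrr (f t)); apply: cvgB => //; exact: cvg_cst.
  rewrite -[(f t)^-1]mul1r -[1 : C]addr0.
  apply: (eq_cvgn _ (cvgM (cvgD BA (bounded_mul_cvg0 Bbd ftA)) (cvg_cst (f t)^-1))).
  by move=> n; rewrite /= fctE mulrBr addrC subrK mulfK.
split; first by near=> t; have [] : f t != 0 /\
  series (fun k => b k * t ^+ k) @ \oo --> (f t)^-1 by near: t.
exists b; split=> //; split=> //.
by near=> t; have [] : f t != 0 /\
  series (fun k => b k * t ^+ k) @ \oo --> (f t)^-1 by near: t.
Unshelve. all: by end_near. Qed.

Lemma is_ps_eq0 (f : C -> C) (a : nat -> C) : is_ps f a ->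
  (\forall t \near (0 : C)^', f t = 0) -> forall k, a k = 0.
Proof.
move=> fa f0; elim/ltn_ind => k IHk; apply/eqP; case: eqP => // /eqP ak.
have := is_ps_divXn IHk fa; rewrite -[k]addn0 in ak.
move=> /(@is_psV _ (fun j => a (k + j)%N) ak) [fn0 _].
have [t [/eqP]] : exists t, f t / t ^+ k != 0 /\ f t = 0.
  by apply: (@filter_ex _ (0 : C)^'); near=> t; split; near: t.
by move=> /[swap] ->; rewrite mul0r.
Unshelve. all: by end_near. Qed.

Lemma is_ps_uniq (f : C -> C) (a b : nat -> C) :
  is_ps f a -> is_ps f b -> a =1 b.
Proof.
move=> fa fb k; apply/eqP; rewrite -subr_eq0 -mulN1r; apply/eqP.
apply: (is_ps_eq0 (is_psD fa (is_psZ (-1) fb))).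
by near=> t; rewrite mulN1r subrr.
Unshelve. all: by end_near. Qed.

Lemma cauchy_prod_delta (m : nat) (a : nat -> C) (k : nat) :
  cauchy_prod (fun j => (j == m)%:R) a (m + k) = a k.
Proof.
have mk : (m < (m + k).+1)%N by rewrite ltnS leq_addr.
rewrite /cauchy_prod (bigD1 (Ordinal mk)) //= eqxx mul1r addKn.
by rewrite big1 ?addr0 // => i im; rewrite (negbTE (im : i != m :> nat)) mul0r.
Qed.

(** * Constant terms *)

Definition has_ct (f : C -> C) (c : C) : Prop :=
  exists N a, is_ps (fun t => t ^+ N * f t) a /\ a N = c.

Lemma has_ct_raise (M N : nat) (f : C -> C) (a : nat -> C) :
  is_ps (fun t => t ^+ N * f t) a ->
  exists b, is_ps (fun t => t ^+ (M + N) * f t) b /\ b (M + N)%N = a N.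
Proof.
move=> fa; exists (cauchy_prod (fun j => (j == M)%:R) a).
split; last exact: cauchy_prod_delta.
by apply: is_ps_near (is_psM (is_ps_Xn M) fa); near=> t; rewrite exprD mulrA.
Unshelve. all: by end_near. Qed.

Lemma has_ct_uniq (f : C -> C) (c d : C) : has_ct f c -> has_ct f d -> c = d.
Proof.
move=> [N [a [fa <-]]] [M [b [fb <-]]].
have [a' [fa' <-]] := has_ct_raise M fa.
have [b' [fb' <-]] := has_ct_raise N fb.
by rewrite addnC in fb' *; exact: is_ps_uniq fa' fb' _.
Qed.

Lemma has_ct_near (f g : C -> C) (c : C) :
  (\forall t \near (0 : C)^', f t = g t) -> has_ct f c -> has_ct g c.
Proof.
move=> fg [N [a [fa aN]]]; exists N, a; split=> //.
apply: is_ps_near fa; near=> t; congr (_ * _); near: t; exact: fg.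
Unshelve. all: by end_near. Qed.

Lemma has_ctD (f g : C -> C) (c d : C) :
  has_ct f c -> has_ct g d -> has_ct (fun t => f t + g t) (c + d).
Proof.
move=> [N [a [fa <-]]] [M [b [fb <-]]].
have [a' [fa' <-]] := has_ct_raise M fa.
have [b' [fb' <-]] := has_ct_raise N fb.
rewrite addnC in fb' *; exists (M + N)%N, (fun k => a' k + b' k); split=> //.
by apply: is_ps_near (is_psD fa' fb'); near=> t; rewrite mulrDr.
Unshelve. all: by end_near. Qed.

Lemma has_ctZ (k : C) (f : C -> C) (c : C) :
  has_ct f c -> has_ct (fun t => k * f t) (k * c).
Proof.
move=> [N [a [fa <-]]]; exists N, (fun j => k * a j); split=> //.
by apply: is_ps_near (is_psZ k fa); near=> t; rewrite mulrCA.
Unshelve. all: by end_near. Qed.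

Lemma has_ct_sum (I : Type) (r : seq I) (P : pred I) (f : I -> C -> C)
    (c : I -> C) :
  (forall i, P i -> has_ct (f i) (c i)) ->
  has_ct (fun t => \sum_(i <- r | P i) f i t) (\sum_(i <- r | P i) c i).
Proof.
move=> fc; elim: r => [|i r IHr].
  rewrite big_nil; exists 0%N, (fun k => 0 * (k == 0)%:R); split; last exact: mul0r.
  apply: is_ps_near (is_psZ 0 (is_ps_Xn 0)).
  by near=> t; rewrite big_nil mulr0 mul0r.
rewrite big_cons; case: ifP => Pi.
  apply: has_ct_near (has_ctD (fc _ Pi) IHr).
  by near=> t; rewrite big_cons Pi.
by apply: has_ct_near IHr; near=> t; rewrite big_cons Pi.
Unshelve. all: by end_near. Qed.

Lemma has_ct_opp (f : C -> C) (c : C) :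
  has_ct f c -> has_ct (fun t => f (- t)) c.
Proof.
move=> [N [a [fa <-]]].
exists N, (fun k => (-1) ^+ N * ((-1) ^+ k * a k)); split; last by rewrite signrMK.
apply: is_ps_near (is_psZ ((-1) ^+ N) (is_ps_opp fa)).
by near=> t; rewrite (exprNn t) -mulrA signrMK.
Unshelve. all: by end_near. Qed.

Lemma cvg0_bounded (u : nat -> C) : u @ \oo --> (0 : C) ->
  exists2 K, 0 <= K & forall n, `|u n| <= K.
Proof.
move=> /cvgr0Pnorm_lt /(_ 1 ltr01)[N _ uN].
exists (1 + \sum_(k < N) `|u k|) => [|n]; first by rewrite addr_ge0 ?sumr_ge0.
case: (ltnP n N) => nN.
  by rewrite (bigD1 (Ordinal nN)) //= addrCA lerDl addr_ge0 ?sumr_ge0.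
by apply: (le_trans (ltW (uN n nN))); rewrite lerDl sumr_ge0.
Qed.

Lemma expr_int_sub (t : C) (j N : nat) : t != 0 ->
  t ^ (j%:Z - N%:Z) = t ^+ j / t ^+ N.
Proof. by move=> t0; rewrite expfzDr // exprnN. Qed.

Lemma has_ct_laurent (f : C -> C) (c : C) : has_ct f c ->
  exists2 a : int -> C, laurent_series_at0 f a & a 0 = c.
Proof.
move=> [N [a [[_ /near0P[e [e0 fa]]] <-]]].
pose b (k : int) := if 0 <= k + N%:Z then a (absz (k + N%:Z)) else 0.
have bE j : b (j%:Z - N%:Z) = a j by rewrite /b subrK.
exists b; last by rewrite -(bE N) subrr.
exists N, e; split=> // [k kN|t te].
  by rewrite /b ifF //; apply/negbTE; rewrite -ltNge -ltrBrDr sub0r.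
have t0 : t != 0 by rewrite -normr_gt0; case/andP: te.
rewrite -[f t](mulKf (expf_neq0 N t0)).
apply: (eq_cvgn _ (cvgM (cvg_cst (t ^+ N)^-1) (fa _ te))) => n.
rewrite /= /series /= mulr_sumr; apply: eq_bigr => j _.
by rewrite bE expr_int_sub // mulrA mulrC.
Qed.

Lemma laurent_has_ct (f : C -> C) (a : int -> C) :
  laurent_series_at0 f a -> has_ct f (a 0).
Proof.
move=> [N [r [r0 _ fa]]]; exists N, (fun j => a (j%:Z - N%:Z)).
split; last by rewrite subrr.
have near_f t : 0 < `|t| < r ->
    series (fun j => a (j%:Z - N%:Z) * t ^+ j) @ \oo --> t ^+ N * f t.
  move=> tr; have t0 : t != 0 by rewrite -normr_gt0; case/andP: tr.
  apply: (eq_cvgn _ (cvgM (cvg_cst (t ^+ N)) (fa _ tr))) => n.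
  rewrite /= /series /= mulr_sumr; apply: eq_bigr => j _.
  by rewrite expr_int_sub // [RHS]mulrC -!mulrA mulVf ?mulr1 // expf_neq0.
split; last by apply/near0P; exists r.
have r2 : 0 < r / 2 by rewrite divr_gt0.
have nr2 : `|r / 2| = r / 2 by rewrite ger0_norm // ltW.
have /near_f/cvgP/cvg_series_cvg_0/cvg0_bounded[K K0 aK] : 0 < `|r / 2| < r.
  by rewrite nr2 r2 ltr_pdivrMr // ltr_pMr // ltr1n.
apply: (@geom_bounded_const _ _ K (r / 2)^-1) => //; first by rewrite invr_ge0 ltW.
move=> j; rewrite exprVn ler_pdivlMr ?exprn_gt0 //.
by have := aK j; rewrite normrM normrX nr2.
Qed.

Lemma has_ctE (f : C -> C) (c : C) : has_ct f c -> constant_term f = c.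
Proof.
move=> fc; apply: (has_ct_uniq _ fc).
have [a fa ac] := has_ct_laurent fc.
have [b fb <-] : [set c | exists2 a : int -> C, laurent_series_at0 f a & a 0 = c]
    (constant_term f).
  by apply: xgetPex; exists c, a.
exact: laurent_has_ct.
Qed.

Lemma is_ps_eqf (f g : C -> C) (a : nat -> C) :
  is_ps f a -> is_ps g a -> \forall t \near (0 : C)^', f t = g t.
Proof.
move=> [_ fa] [_ ga]; near=> t.
have ft : series (fun k => a k * t ^+ k) @ \oo --> f t by near: t.
have gt : series (fun k => a k * t ^+ k) @ \oo --> g t by near: t.
exact: norm_cvg_unique ft gt.
Unshelve. all: by end_near. Qed.

Lemma is_ps_sum (I : Type) (r : seq I) (P : pred I) (f : I -> C -> C)
    (c : I -> C) :
    (forall i, P i -> exists a, is_ps (f i) a /\ a 0%N = c i) ->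
  exists a, is_ps (fun t => \sum_(i <- r | P i) f i t) a /\
            a 0%N = \sum_(i <- r | P i) c i.
Proof.
move=> fc; elim: r => [|i r [a [fa a0]]].
  exists (fun k => 0 * (k == 0)%:R); rewrite big_nil mul0r; split=> //.
  apply: is_ps_near (is_psZ 0 (is_ps_Xn 0)).
  by near=> t; rewrite big_nil mul0r.
case: (boolP (P i)) => Pi; last first.
  exists a; rewrite big_cons (negbTE Pi); split=> //.
  by apply: is_ps_near fa; near=> t; rewrite big_cons (negbTE Pi).
have [b [fb b0]] := fc _ Pi.
exists (fun k => b k + a k); rewrite big_cons Pi b0 a0; split=> //.
by apply: is_ps_near (is_psD fb fa); near=> t; rewrite big_cons Pi.
Unshelve. all: by end_near. Qed.

Lemma is_ps_prod (I : Type) (r : seq I) (P : pred I) (f : I -> C -> C)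
    (c : I -> C) :
    (forall i, P i -> exists a, is_ps (f i) a /\ a 0%N = c i) ->
  exists a, is_ps (fun t => \prod_(i <- r | P i) f i t) a /\
            a 0%N = \prod_(i <- r | P i) c i.
Proof.
move=> fc; elim: r => [|i r [a [fa a0]]].
  exists (fun k => (k == 0)%:R); rewrite big_nil; split=> //.
  by apply: is_ps_near (is_ps_Xn 0); near=> t; rewrite big_nil expr0.
case: (boolP (P i)) => Pi; last first.
  exists a; rewrite big_cons (negbTE Pi); split=> //.
  by apply: is_ps_near fa; near=> t; rewrite big_cons (negbTE Pi).
have [b [fb b0]] := fc _ Pi.
exists (cauchy_prod b a); rewrite big_cons Pi /cauchy_prod big_ord1 b0 a0.
split=> //; apply: is_ps_near (is_psM fb fa).
by near=> t; rewrite big_cons Pi.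
Unshelve. all: by end_near. Qed.

Context (exp_cvg : forall z : C, cvgn (series (fun k => z ^+ k / k`!%:R))).

Lemma is_ps_cexp (c : C) :
  is_ps (fun t => cexp (t * c)) (fun k => c ^+ k / k`!%:R).
Proof.
split.
  apply: (@geom_bounded_const _ _ 1 `|c|) => // k.
  rewrite mul1r normrM normrX normfV normr_nat ler_piMr ?exprn_ge0 //.
  by rewrite invf_le1 ?ltr0n ?ler1n ?fact_gt0.
near=> t.
have E : series (fun k => (t * c) ^+ k / k`!%:R) @ \oo --> cexp (t * c).
  exact: exp_cvg.
apply: (eq_cvgn _ E) => n.
rewrite /series /=; apply: eq_bigr => k _.
by rewrite exprMn mulrAC [t ^+ k * _]mulrC.
Unshelve. all: by end_near. Qed.

Lemma cauchy_prod_exp (c d : C) (k : nat) :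
  cauchy_prod (fun j => c ^+ j / j`!%:R) (fun j => d ^+ j / j`!%:R) k =
  (c + d) ^+ k / k`!%:R.
Proof.
rewrite addrC exprDn mulr_suml; apply: eq_bigr => i _.
have ik : (i <= k)%N by rewrite -ltnS.
have f0 j : j`!%:R != 0 :> C by rewrite pnatr_eq0 -lt0n fact_gt0.
rewrite -(bin_fact ik) -mulr_natr !natrM.
have := f0 k; rewrite -(bin_fact ik) !natrM => bf.
by field; rewrite !f0 /=; apply: contraNneq bf => ->; rewrite mul0r.
Qed.

Lemma cexp_mulN (c : C) :
  \forall t \near (0 : C)^', cexp (t * c) * cexp (- t * c) = 1.
Proof.
apply: (@is_ps_eqf _ _ (cauchy_prod (fun j => c ^+ j / j`!%:R)
    (fun j => (- c) ^+ j / j`!%:R))).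
  apply: is_ps_near (is_psM (is_ps_cexp c) (is_ps_cexp (- c))).
  by near=> t; rewrite mulrN mulNr.
apply: is_ps_near (_ : is_ps (fun t => t ^+ 0) _); first by near=> t; rewrite expr0.
rewrite (_ : cauchy_prod _ _ = fun k => (k == 0)%:R); first exact: is_ps_Xn.
apply/funext => k; rewrite cauchy_prod_exp subrr expr0n.
by case: k => [|k]; rewrite ?mul0r ?divr1.
Unshelve. all: by end_near. Qed.

Lemma is_ps_todd (x : C) : x != 0 ->
  (\forall t \near (0 : C)^', 1 - cexp (t * x) != 0) /\
  exists a, is_ps (fun t => t / (1 - cexp (t * x))) a /\ a 0%N = - x^-1.
Proof.
move=> x0; pose b (k : nat) : C := (k == 0)%:R + -1 * (x ^+ k / k`!%:R).
have fb : is_ps (fun t => t ^+ 0 + -1 * cexp (t * x)) b.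
  exact: is_psD (is_ps_Xn 0) (is_psZ (-1) (is_ps_cexp x)).
have b0 k : (k < 1)%N -> b k = 0.
  by case: k => // _; rewrite /b divr1 mulr1 subrr.
have b1 : b (1 + 0)%N = - x by rewrite /b add0r divr1 mulN1r.
have b1n0 : b (1 + 0)%N != 0 by rewrite b1 oppr_eq0.
have [n0 [a [fa a0]]] := is_psV b1n0 (is_ps_divXn b0 fb).
split.
  near=> t; have : (t ^+ 0 + -1 * cexp (t * x)) / t ^+ 1 != 0 by near: t.
  by apply: contraNneq => e0; rewrite expr0 mulN1r e0 mul0r.
exists a; split; last by rewrite a0 b1 invrN.
by apply: is_ps_near fa; near=> t; rewrite invf_div expr0 mulN1r.
Unshelve. all: by end_near. Qed.

Section ConstantTerms.
Context (n : nat) (x : 'I_n -> C) (x_neq0 : forall a, x a != 0).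

Lemma B_elem_sym (p : nat) (c t : C) :
  B p c x t = cexp (t * c) * elem_sym p (fun a => (1 - cexp (t * x a))^-1).
Proof.
by rewrite /B /elem_sym mulr_sumr; apply: eq_bigr => J _; rewrite prodfV.
Qed.

Lemma elem_symZ (p : nat) (t : C) (u : 'I_n -> C) :
  elem_sym p (fun a => t * u a) = t ^+ p * elem_sym p u.
Proof.
rewrite /elem_sym mulr_sumr; apply: eq_bigr => J /eqP <-.
by rewrite big_split prodr_const.
Qed.

Lemma V_elem_sym (p : nat) (c t : C) : t != 0 ->
  t ^+ p * V p c x t = elem_sym p (fun a => - (x a)^-1) * cexp (t * c).
Proof.
move=> t0; rewrite mulrC /V /elem_sym !mulr_suml; apply: eq_bigr => J /eqP Jp.
rewrite -Jp -prodr_const [RHS]mulrC -mulrA -prodfV -big_split /=; congr (_ * _).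
by apply: eq_bigr => a _; rewrite -mulrN invfM mulrAC mulVf ?mul1r ?invrN.
Qed.

Lemma has_ct_expansion : exists G : nat -> nat -> C,
  (forall p c, has_ct (B p c x)
    (\sum_(k < p.+1) c ^+ k / k`!%:R * G p (p - k)%N)) /\
  (forall p c, has_ct (V p c x) (c ^+ p / p`!%:R * G p 0%N)).
Proof.
have /choice[G GP] (p : nat) : exists g,
    is_ps (fun t => elem_sym p (fun a => t / (1 - cexp (t * x a)))) g /\
    g 0%N = elem_sym p (fun a => - (x a)^-1).
  apply: is_ps_sum => J _; apply: is_ps_prod => a _.
  by case: (is_ps_todd (x_neq0 a)).
exists G; split=> p c; have [Gps G0] := GP p.
  exists p, (cauchy_prod (fun k => c ^+ k / k`!%:R) (G p)); split=> //.
  apply: is_ps_near (is_psM (is_ps_cexp c) Gps).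
  by near=> t; rewrite B_elem_sym elem_symZ mulrCA.
exists p, (fun k => G p 0%N * (c ^+ k / k`!%:R)); split; last exact: mulrC.
rewrite G0; apply: is_ps_near (is_psZ _ (is_ps_cexp c)).
near=> t; rewrite V_elem_sym //; near: t; exact: near0_neq0.
Unshelve. all: by end_near. Qed.

Lemma CTB_reflection (p : nat) (c : C) : (p <= n)%N ->
  CTB p c x =
  \sum_(j < p.+1) (-1) ^+ j * 'C(n - j, p - j)%:R * CTB j (- c) x.
Proof.
move=> pn; apply: has_ctE.
have hB q d : has_ct (B q d x) (CTB q d x).
  have [G [GB _]] := has_ct_expansion.
  by rewrite /CTB (has_ctE (GB q d)); exact: GB.
have n0' : \forall t \near (0 : C)^', forall a, 1 - cexp (t * x a) != 0.
  by apply: filter_forall => a; case: (is_ps_todd (x_neq0 a)).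
have nN' : \forall t \near (0 : C)^', forall a,
    cexp (t * x a) * cexp (- t * x a) = 1.
  by apply: filter_forall => a; exact: cexp_mulN.
apply: has_ct_near (has_ct_sum (index_enum 'I_p.+1) (P := xpredT)
  (fun j _ => has_ctZ ((-1) ^+ j * 'C(n - j, p - j)%:R)
     (has_ct_opp (hB j (- c))))).
near=> t.
have n0 : forall a, 1 - cexp (t * x a) != 0 by near: t.
have nN : forall a, cexp (t * x a) * cexp (- t * x a) = 1 by near: t.
rewrite [RHS]B_elem_sym.
have uN a : (1 - cexp (t * x a))^-1 = 1 - (1 - cexp (- t * x a))^-1.
  have E0 : cexp (t * x a) != 0.
    by apply: contraTneq (oner_neq0 C) => E0; rewrite -(nN a) E0 mul0r eqxx.
  have -> : cexp (- t * x a) = (cexp (t * x a))^-1.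
    by rewrite -[RHS]mulr1 -(nN a) mulKf.
  have EN : cexp (t * x a) - 1 != 0 by rewrite -opprB oppr_eq0.
  by field; rewrite E0 n0 EN.
rewrite [X in _ = _ * X](_ : _ =
    elem_sym p (fun a => 1 - (1 - cexp (- t * x a))^-1)).
  rewrite elem_sym_compl // mulr_sumr; apply: eq_bigr => j _.
  by rewrite B_elem_sym mulrNN mulrCA.
by apply: eq_bigr => J _; apply: eq_bigr => a _; exact: uN.
Unshelve. all: by end_near. Qed.
End ConstantTerms.
End PowerSeries.

(** * The complex numbers *)

Lemma norm_real_complex (R : rcfType) (a : R) : `|a%:C%C| = `|a|%:C%C.
Proof. by rewrite normc_def /= expr0n addr0 sqrtr_sqr. Qed.

Lemma norm_complexi (R : rcfType) : `|'i%C : R[i]| = 1.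
Proof. by rewrite normc_def /= expr0n add0r expr1n sqrtr1. Qed.

Lemma cvg_complex (R : realType) (u : nat -> R[i]) (a b : R) :
    (fun n => complex.Re (u n)) @ \oo --> a ->
    (fun n => complex.Im (u n)) @ \oo --> b ->
  (u : nat -> (R[i] : numFieldType)) @ \oo -->
    ((a +i* b)%C : (R[i] : numFieldType)).
Proof.
move=> ua ub; apply/(@cvgrPdist_lt (R[i] : numFieldType)) => e.
rewrite ltcE => /andP[/eqP /= e0 e_gt0].
have -> : e = (complex.Re e)%:C%C by rewrite [LHS]complexE e0 mulr0 addr0.
move: (complex.Re e) e_gt0 => {e0}e e_gt0.
have e2 : 0 < e / 2 by rewrite divr_gt0.
near=> n.
have -> : (a +i* b)%C - u n = (a - complex.Re (u n))%:C%C +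
    'i%C * (b - complex.Im (u n))%:C%C.
  by rewrite [LHS]complexE; case: (u n).
apply: (le_lt_trans (ler_normD _ _)).
rewrite normrM norm_complexi mul1r.
rewrite !norm_real_complex -rmorphD ltcR [ltRHS]splitr ltrD //; near: n.
  by move/cvgrPdist_lt : ua; apply.
by move/cvgrPdist_lt : ub; apply.
Unshelve. all: by end_near. Qed.

Lemma cvg_half_complex (R : realType) :
  (fun n => 2^-1 ^+ n : (R[i] : numFieldType)) @ \oo -->
    (0 : (R[i] : numFieldType)).
Proof.
have E n : 2^-1 ^+ n = (2^-1 ^+ n)%:C%C :> R[i].
  by rewrite rmorphXn fmorphV rmorph_nat.
apply: (@cvg_complex _ _ 0 0).
  rewrite (_ : (fun n => _) = GRing.exp (2^-1 : R)); last first.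
    by apply/funext => n; rewrite E.
  by apply: cvg_expr; rewrite ger0_norm ?invr_ge0 // invf_lt1 // ltr1n.
rewrite (_ : (fun n => _) = fun=> 0); first exact: cvg_cst.
by apply/funext => n; rewrite E.
Unshelve. all: by end_near. Qed.

Lemma Re_series (R : rcfType) (u : nat -> R[i]) (n : nat) :
  complex.Re (series u n) = series (fun k => complex.Re (u k)) n.
Proof. exact: (raddf_sum (@complex.Re R : Rcomplex R -> R)). Qed.

Lemma Im_series (R : rcfType) (u : nat -> R[i]) (n : nat) :
  complex.Im (series u n) = series (fun k => complex.Im (u k)) n.
Proof. exact: (raddf_sum (@complex.Im R : Rcomplex R -> R)). Qed.

Lemma cvg_exp_complex (R : realType) (z : (R[i] : numFieldType)) :
  cvgn (series (fun k => z ^+ k / k`!%:R)).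
Proof.
pose r := complex.Re `|z|; pose u k := z ^+ k / k`!%:R.
have zr : `|z| = r%:C%C by rewrite RRe_real ?normr_real.
have uE k : `|u k| = (exp_coeff r k)%:C%C.
  rewrite normrM normfV normr_nat normrX zr /exp_coeff /=.
  by rewrite rmorphM rmorphXn fmorphV rmorph_nat.
have Re_le k : `|complex.Re (u k)| <= exp_coeff r k.
  by rewrite -lecR -uE normc_ge_Re.
have Im_le k : `|complex.Im (u k)| <= exp_coeff r k.
  rewrite -lecR -uE.
  have := normc_ge_Re (u k * 'i%C); rewrite ReiNIm normrN normrM.
  by rewrite norm_complexi mulr1.
have cv (v : nat -> R) : (forall k, `|v k| <= exp_coeff r k) -> cvgn (series v).
  move=> vr; apply: normed_cvg.
  apply: (series_le_cvg _ _ vr (is_cvg_series_exp_coeff r)) => // k.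
  exact: le_trans (vr k).
apply: cvgP; apply: cvg_complex.
  by under eq_fun do rewrite Re_series; exact: cv _ Re_le.
by under eq_fun do rewrite Im_series; exact: cv _ Im_le.
Qed.

Local Open Scope complex_scope.

Theorem theorem4p1 (R : realType) (n : nat) (s : R[i]) (x : 'I_n -> R[i])
    (n_gt0 : (0 < n)%N) (x_neq0 : forall a, x a != 0) :
  (odd n ->
    let m := n.+1./2 in
    \sum_(0 <= p < n.+1) (-1) ^+ (n - p) * (p.+1)`!%:R * CTV p s x =
    \sum_(m <= p < n.+1) (-1) ^+ p *
      \sum_(1 <= i < (p.+1 - m).+1)
        (-1) ^+ (m - i) * 'C(p.+1, m + i)%:R * 2 * i%:R
          * CTB p (- (i%:R * s)) x)
  /\
  (~~ odd n ->
    let m := n./2 in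
    \sum_(0 <= p < n.+1) (-1) ^+ (n - p) * (p.+1)`!%:R * CTV p s x =
    \sum_(m <= p < n.+1) (-1) ^+ p *
      \sum_(1 <= i < (p.+1 - m).+1)
        (-1) ^+ (m.+1 - i)
          * ('C(p.+1, m + i)%:R - 'C(p.+1, (m + i).+1)%:R) * i%:R
          * CTB p (- (i%:R * s)) x).
Proof.
have [G [GB GV]] := has_ct_expansion (@cvg_half_complex R)
  (@cvg_exp_complex R) x_neq0.
have CTBE p c : CTB p c x = \sum_(k < p.+1) c ^+ k / k`!%:R * G p (p - k)%N.
  exact: (has_ctE (@cvg_half_complex R) (GB p c)).
have CTVE p : CTV p s x = s ^+ p / p`!%:R * G p 0%N.
  exact: (has_ctE (@cvg_half_complex R) (GV p s)).
have [odd_n even_n] := bin_reflection_parity s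
  (fun p c _ => CTBE p c)
  (CTB_reflection (@cvg_half_complex R) (@cvg_exp_complex R) x_neq0).
by split=> nP m; [rewrite -odd_n | rewrite -even_n] => //;
  apply: eq_bigr => p _; rewrite CTVE.
Qed.
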